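(* Let $X$ be a compact metric space with metric $\rho$ and let $k\ge 1$ be an integer. Then $\dim_L(X)\le k-1$ if and only if for every $\epsilon>0$ there exist a number $\delta$ with $0<\delta<\epsilon$ and a hypergraph $\mathcal{H}(\epsilon)$ on a finite vertex set $V(\mathcal{H}(\epsilon))$ with edge set $E(\mathcal{H}(\epsilon))=\{e_x : x\in X\}$ (a family of subsets of $V(\mathcal{H}(\epsilon))$ indexed by the points of $X$) such that: 1) the rank of $\mathcal{H}(\epsilon)$ is at most $k$; 2) $e_x\cap e_y\neq\emptyset$ for all $x,y\in X$ with $\rho(x,y)<\delta$; 3) $\rho(x,y)<\epsilon$ for all $x,y\in X$ with $e_x\cap e_y\neq\emptyset$; 4) for every $v\in V(\mathcal{H}(\epsilon))$ the set $X_v=\{x\in X : v\in e_x\}$ is open in $X$.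
   Context: The rank of a hypergraph is the maximal size of its edges. A cover of a compact metric space $X$ is a family $\mathcal{C}$ of open subsets of $X$ whose union is $X$. A cover is a $k$-cover if every $x\in X$ belongs to at most $k$ sets of $\mathcal{C}$; an $\epsilon$-cover if every set in $\mathcal{C}$ has diameter at most $\epsilon$; an $(\epsilon,k)$-cover if it is both an $\epsilon$-cover and a $k$-cover. The Lebesgue (covering) dimension $\dim_L(X)$ is the minimal integer $k$ such that for every $\epsilon>0$ there exists an $(\epsilon,k+1)$-cover of $X$. The sets $e_x$ for different points $x$ are allowed to coincide as sets. *)

(* Defs.v *)
From HB Require Import structures.
From mathcomp Require Import all_boot all_order all_algebra.
From mathcomp Require Import all_classical all_reals all_analysis.

Set Implicit Arguments.
Unset Strict Implicit.
Unset Printing Implicit Defensive.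

Import Order.TTheory GRing.Theory Num.Theory.

Local Open Scope classical_set_scope.
Local Open Scope ring_scope.

(* The diameter is an extended real; that of the empty set is -oo, so it is
   at most every real number. *)
Definition diameter (R : realType) (X : metricType R) (A : set X) : \bar R :=
  ereal_sup [set (mdist x y)%:E | x in A & y in A].

Definition is_open_cover (X : topologicalType) (C : set (set X)) : Prop :=
  (forall U, C U -> open U) /\ \bigcup_(U in C) U = [set: X].

Definition is_eps_cover (R : realType) (X : metricType R) (eps : R)
    (C : set (set X)) : Prop :=
  is_open_cover C /\ forall U, C U -> (diameter U <= eps%:E)%E.

Definition is_k_cover (X : topologicalType) (k : nat) (C : set (set X)) :
    Prop :=
  is_open_cover C /\ forall x : X, ([set U | C U /\ U x] #<= `I_k)%card.

Definition has_small_k_covers (R : realType) (X : metricType R) (k : nat) :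
    Prop :=
  forall eps : R, 0 < eps ->
    exists C : set (set X), is_eps_cover eps C /\ is_k_cover k C.

(* One less than the least n : nat such that X has (eps, n)-covers for every
   eps > 0; it is -1 exactly when X is empty, and +oo if there is no such n. *)
Definition covering_dim (R : realType) (X : metricType R) : \bar int :=
  match pselect (exists n, `[< has_small_k_covers X n >]) with
  | left ex_n => (Posz (ex_minn ex_n) - 1)%:E
  | right _ => +oo%E
  end.

(* A hypergraph on a finite vertex set V is given by its set E of edges. *)
Definition hypergraph_rank (V : finType) (E : set {set V}) : nat :=
  \max_(A : {set V} | `[< E A >]) #|A|.

(* Main.v *)
(* If X has an (eps/2, k)-cover, compactness yields a finite subcover together
   with a Lebesgue number; the members of the subcover are the vertices, and
   the edge e_x consists of those containing x. Conversely, the sets X_v of a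
   hypergraph for eps form an (eps, k)-cover. *)
Require Import Defs.
From HB Require Import structures.
From mathcomp Require Import all_boot all_order all_algebra.
From mathcomp Require Import finmap.
From mathcomp Require Import all_classical all_reals all_analysis.

Import Order.TTheory GRing.Theory Num.Theory.
Local Open Scope classical_set_scope.
Local Open Scope ring_scope.

Lemma card_eq_setP (T : finType) (A : {set T}) : ([set` A] #= `I_#|A|)%card.
Proof.
have -> : [set` A] = [set` [fset x in A]%fset].
  by apply/seteqP; split => x /=; rewrite !inE.
by apply/card_eq_fsetP; rewrite card_imfset //= -cardE.
Qed.

Lemma hypergraph_rank_range (T : Type) (V : finType) (e : T -> {set V})
    (k : nat) :
  (hypergraph_rank (range e) <= k)%N <-> (forall x, #|e x| <= k)%N.
Proof.
split=> [/bigmax_leqP h x|h]; first by apply: h; apply/asboolP; exists x.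
by apply/bigmax_leqP => _ /asboolP[x _ <-].
Qed.

(* The near-covering form of compactness is applied to the filter of pairs
   (finite subfamily of C, radius), ordered by enlarging the subfamily and
   shrinking the radius; unlike [compact_cover], it does not require a pointed
   space. *)
Lemma compact_finite_lebesgue_number (R : realType) (X : pseudoMetricType R)
    (C : set (set X)) :
  compact [set: X] -> is_open_cover C ->
  exists (D : {fset set X}) (delta : R),
    [/\ 0 < delta, [set` D] `<=` C &
        forall x, exists2 U, U \in D & ball x delta `<=` U].
Proof.
move=> /compact_near_coveringP cX [Copen Ccover].
pose dom := [set q : {fset set X} * R | [set` q.1] `<=` C /\ 0 < q.2].
pose refines (p q : {fset set X} * R) :=
  [/\ dom q, (p.1 `<=` q.1)%fset & q.2 <= p.2].
have Ffilter : Filter (filter_from dom refines).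
  apply: filter_from_filter; first by exists (fset0, 1); split.
  move=> [D1 r1] [D2 r2] [/= D1C r1_gt0] [/= D2C r2_gt0].
  exists ((D1 `|` D2)%fset, Num.min r1 r2).
    split=> /=; last by rewrite lt_min r1_gt0.
    by move=> U /=; rewrite inE => /orP[/D1C|/D2C].
  move=> [D r] [/= domDr]; rewrite fsubUset le_min.
  by move=> /andP[sD1 sD2] /andP[le1 le2]; split; split.
have [x _|[D delta] [DC delta_gt0] Dball] :=
    cX _ _ (fun q x => exists2 U, U \in q.1 & ball x q.2 `<=` U) Ffilter.
  have : [set: X] x by [].
  rewrite -Ccover => -[U CU Ux].
  have /nbhs_ballP[d /= d_gt0 dU] : nbhs x U.
    by apply: open_nbhs_nbhs; split=> //; exact: Copen.
  (* Halving [d] leaves room for a triangle inequality: if [y] is within [d / 2] of [x], the ball of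
     radius [d / 2] about [y] stays in [ball x d], hence in [U]. *)
  exists (ball x (d / 2), refines ([fset U]%fset, d / 2)).
    split=> /=; first by apply: nbhsx_ballx; rewrite divr_gt0.
    exists ([fset U]%fset, d / 2) => //; split=> /=; last by rewrite divr_gt0.
    by move=> V /=; rewrite inE => /eqP ->.
  move=> [y [D r]] [/= xy [_ /= UD rd]]; exists U.
    by move/fsubsetP: UD; apply; rewrite inE.
  move=> z yz; apply: dU; apply: ball_split xy _.
  exact: le_ball yz.
(* The pair [(D, delta)] refines itself, so it belongs to the base set on which [Dball] holds. *)
exists D, delta; split=> // x.
by apply: (Dball (D, delta)).
Qed.

Lemma has_small_k_covers_mono (R : realType) (X : metricType R) (m n : nat) :
  (m <= n)%N -> has_small_k_covers X m -> has_small_k_covers X n.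
Proof.
move=> mn Xm eps /Xm [C [Ceps [Cop Cm]]]; exists C; split=> //; split=> // x.
by apply: card_le_trans (Cm x) _; rewrite card_le_II.
Qed.

(** By monotonicity the admissible [n] form an up-set, so the least one is at most [k] exactly when
    [k] is admissible. If none is admissible, the dimension is [+oo] and both sides fail. *)
Lemma covering_dim_leP (R : realType) (X : metricType R) (k : nat) :
  (covering_dim X <= (Posz k - 1)%:E)%E <-> has_small_k_covers X k.
Proof.
rewrite /covering_dim; case: pselect => [ex_n|no_n]; last first.
  by split=> // Xk; case: no_n; exists k; apply/asboolP.
case: ex_minnP => n /asboolP Xn n_min; rewrite lee_fin lerD2r lez_nat.
by split=> [nk|Xk]; [exact: has_small_k_covers_mono Xn | apply/n_min/asboolP].
Qed.

Lemma diameter_leP (R : realType) (X : metricType R) (A : set X) (r : R) :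
  (diameter A <= r%:E)%E <-> (forall x y, A x -> A y -> mdist x y <= r).
Proof.
split=> [/ereal_supP Ar x y Ax Ay|Ar].
  by rewrite -lee_fin; apply: Ar; exists x => //; exists y.
by apply/ereal_supP => _ [x Ax [y Ay <-]]; rewrite lee_fin; exact: Ar.
Qed.

Theorem theorem3 (R : realType) (X : metricType R)
    (compactX : compact [set: X]) (k : nat) (k_ge1 : (1 <= k)%N) :
  (covering_dim X <= (Posz k - 1)%:E)%E <->
  (forall eps : R, 0 < eps ->
    exists (delta : R) (V : finType) (e : X -> {set V}),
      [/\ 0 < delta < eps,
          (hypergraph_rank (range e) <= k)%N,
          (forall x y : X, mdist x y < delta -> e x :&: e y != finset.set0),
          (forall x y : X, e x :&: e y != finset.set0 -> mdist x y < eps) &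
          (forall v : V, open [set x : X | v \in e x])]).
Proof.
rewrite covering_dim_leP; split=> [Xk eps eps_gt0|Xhyp eps eps_gt0].
  (* Diameters only satisfy a weak bound; [eps / 2] makes the distances strictly less than [eps]. *)
  have eps2_gt0 : 0 < eps / 2 by rewrite divr_gt0.
  have [C [[[Copen Ccover] Cdiam] [_ Ck]]] := Xk _ eps2_gt0.
  have [D [d [d_gt0 DC Dball]]] :=
    compact_finite_lebesgue_number _ _ _ compactX (conj Copen Ccover).
  pose e x : {set D} := [set v : D | `[< val v x >]]%SET.
  (* The Lebesgue number [d] makes nearby points share a vertex; the minimum with [eps / 2] ensures
     [delta < eps]. *)
  exists (Num.min d (eps / 2)), D, e; split.
  - by rewrite lt_min d_gt0 eps2_gt0 gt_min ltr_pdivrMr// ltr_pMr// ltr1n orbT.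
  - apply/hypergraph_rank_range => x; rewrite -card_le_II.
    (* The injection [val] sends [e x] into the members of [C] containing [x]. *)
    rewrite -(card_le_eql (card_eq_setP _ (e x))).
    apply: card_le_trans (Ck x).
    rewrite -(card_le_eql (inj_card_eq (in2W (@val_inj _ _ D)))).
    apply: subset_card_le => _ [v /= /[!inE] vx <-].
    by split; [exact: DC (valP v) | exact: vx].
  - move=> x y; rewrite lt_min => /andP[xy _].
    have [U UD xU] := Dball x.
    apply/set0Pn; exists [` UD]%fset; rewrite !inE /=.
    apply/andP; split; apply/asboolP; apply: xU; first exact: ballxx.
    by rewrite ballEmdist.
  - move=> x y /set0Pn[v]; rewrite !inE => /andP[/asboolP vx /asboolP vy].
    have /Cdiam/diameter_leP vdiam : C (val v) by apply: DC; exact: valP.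
    apply: le_lt_trans (vdiam _ _ vx vy) _.
    by rewrite ltr_pdivrMr// ltr_pMr// ltr1n.
  - move=> v; have -> : [set x | v \in e x] = val v.
      by apply/seteqP; split=> x /=; rewrite inE => /asboolP.
    by apply/Copen/DC; exact: valP.
have [delta [V [e [/andP[delta_gt0 _] ek e_meet e_dist eopen]]]] :=
  Xhyp _ eps_gt0.
pose Xv v := [set x | v \in e x].
have Copen : is_open_cover (range Xv).
  split=> [_ [v _ <-]|]; first exact: eopen.
  apply/seteqP; split=> // x _.
  (* Condition 2 with [y = x] shows that [e x] is nonempty, so the sets [Xv v] cover [X]. *)
  have /set0Pn[v] : e x :&: e x != finset.set0 by apply: e_meet; rewrite mdistxx.
  by rewrite inE => /andP[vx _]; exists (Xv v) => //; exists v.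
exists (range Xv); split; split=> //.
  move=> _ [v _ <-]; apply/diameter_leP => x y vx vy; apply/ltW/e_dist.
  by apply/set0Pn; exists v; rewrite inE; apply/andP.
(* Distinct vertices may give the same set, but the members of the cover containing [x] lie in the
   image of [e x] under [Xv], so there are at most [#|e x|] of them. *)
move=> x; apply: (@card_le_trans _ _ _ [set` e x]); last first.
  rewrite (card_le_eql (card_eq_setP _ (e x))) card_le_II.
  by move: x; apply/hypergraph_rank_range.
apply: card_le_trans (card_image_le Xv [set` e x]).
by apply: subset_card_le => _ [[v _ <-] vx]; exists v.
Qed.
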